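(* For every $m\ge1$ there are two nonisomorphic full-support binary context machines $G_P,G_Q$ of order $m$, generating processes $P,Q$, such that each of them is an exact finite-state generator $\epsilon$-machine with $2^m$ states, $L_{\mathrm{tar}}=m$, $L_{\mathrm{sep}}=1$, synchronization order $L_{\mathrm{syn}}=m$, Markov order $m$ and process Hankel matrix of rank $2^m$, and such that $P_m=Q_m$ while $P_{m+1}\neq Q_{m+1}$. Consequently, the block law of length $m$ does not give uniform identifiability on $\Theta_{\mathrm{ex}}(m,1)$ (over the alphabet $\{0,1\}$); that is, there are $P,Q\in\Theta_{\mathrm{ex}}(m,1)$ with $P_m=Q_m$ and $G_P\not\cong G_Q$.
   Context: Words. $\mathcal X$ is a nonempty finite alphabet (here $\{0,1\}$), $\mathcal X^m$ the words of length $m$, $\mathcal X^*$ all finite words, $\lambda$ the empty word; $X_i^j=(X_i,\dots,X_j)$. Generator. A finite-state generator $\epsilon$-machine over $\mathcal X$ is $G=(\mathcal S,\pi,\delta,\{e_\sigma\}_{\sigma\in\mathcal S})$ where: (1) $\mathcal S$ is a nonempty finite set of states and each $e_\sigma$ is a probability mass function on $\mathcal X$; (2) a pair $(\sigma,x)$ is admissible when $e_\sigma(x)>0$, and a successor $\delta(\sigma,x)\in\mathcal S$ is defined exactly on admissible pairs; (3) the directed graph of positive-probability labeled transitions $\sigma\to\delta(\sigma,x)$ is strongly connected; (4) for $\sigma\neq\tau$ there is a word $w\in\mathcal X^*$ with $p_\sigma(w)\neq p_\tau(w)$, where $p_\sigma(w)=P(X_1^{|w|}=w\mid S_0=\sigma)$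 (so $p_\sigma(\lambda)=1$); (5) $\pi$ is the unique probability vector with $\pi T=\pi$, where $T_{\sigma\tau}=\sum_{x:\,e_\sigma(x)>0,\ \delta(\sigma,x)=\tau}e_\sigma(x)$. The dynamics are $P(X_{t+1}=x,S_{t+1}=\delta(\sigma,x)\mid S_t=\sigma)=e_\sigma(x)$ for admissible $(\sigma,x)$, and the process generated by $G$ is the observable process $(X_t)_{t\in\mathbb Z}$ of the stationary joint law with $S_0\sim\pi$. Context machines. The full-support binary context presentation of order $m\ge1$ with parameters $p_u\in(0,1)$, $u\in\{0,1\}^m$, has state set $\{0,1\}^m$, update $\delta(u,x)=u_2\cdots u_mx$ (equal to $x$ when $m=1$), and emissions $e_u(1)=p_u$, $e_u(0)=1-p_u$. Block laws. $P_n(w)=P(X_1^n=w)$ for $w\in\mathcal X^n$, $P_0(\lambda)=1$. Synchronization. A positive-probability word $w\in\mathcal X^k$, $k\ge0$, synchronizes to $\sigma$ if $P(S_k=\sigma\mid X_1^k=w)=1$ (conditioning on $\lambda$ is trivial). It synchronizes if it synchronizes to some state. $G$ is exact if it has a finite positive-probability synchronizing word. Radii. $L_{\mathrm{tar}}(G)=\max_{\sigma\in\mathcal S}\inf\{|w|: w\text{ synchronizes to }\sigma\}$ and $L_{\mathrm{sep}}(G)=\max_{\sigma\neq\tau}\min\{|v|:p_\sigma(v)\neq p_\tau(v)\}$ (both $0$ for a one-state generator). $L_{\mathrm{syn}}(G)=\inf\{k:\text{every positive-probability word in }\mathcal X^k\text{ synchronizes}\}$. Here $\inf\emptyset=\infty$.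 Markov order. The least $k\ge0$ such that the conditional law of the next symbol given the entire past depends only on the last $k$ symbols, almost surely. Process Hankel matrix: $H_{u,v}=P(uv)$, $u,v\in\mathcal X^*$, where $P(w)=P(X_1^{|w|}=w)$. Class. $\Theta_{\mathrm{ex}}(A,D)$ is the class of stationary processes $P$ over the fixed alphabet generated by an exact finite-state generator $\epsilon$-machine $G_P$ with $L_{\mathrm{tar}}(G_P)\le A$ and $L_{\mathrm{sep}}(G_P)\le D$. A summary $\Psi$ gives uniform identifiability on a class $\Theta$ if for all $P,Q\in\Theta$, $\Psi(P)=\Psi(Q)$ implies $G_P\cong G_Q$. Isomorphism. $G\cong G'$ if there is a bijection $f:\mathcal S\to\mathcal S'$ with $\pi'(f(\sigma))=\pi(\sigma)$, $e'_{f(\sigma)}(x)=e_\sigma(x)$ and $\delta'(f(\sigma),x)=f(\delta(\sigma,x))$ for every admissible $(\sigma,x)$. *)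

(* Defs.v *)
From HB Require Import structures.
From mathcomp Require Import all_boot all_order all_algebra.
From mathcomp Require Import all_classical all_reals all_analysis.
Set Implicit Arguments.
Unset Strict Implicit.
Unset Printing Implicit Defensive.
Import Order.TTheory GRing.Theory Num.Theory.
Local Open Scope classical_set_scope.
Local Open Scope ring_scope.

(* The alphabet is {0,1} = bool, with 1 = true; words are
   [seq bool] and the empty word is [::]. *)

(* Raw data (S, pi, delta, e); [step] is partial, with value [None] where
   delta is undefined. *)
Record presentation (R : realType) := Presentation {
  state : finType;
  init : state -> R;
  step : state -> bool -> option state;
  emit : state -> bool -> R
}.

Section Generators.
Variables (R : realType) (G : presentation R).
Implicit Types (s t r : state G) (x : bool) (w v : seq bool).

(* P(X_{t+1} = x, S_{t+1} = r | S_t = s) *)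
Definition edge_prob s x r : R := if step s x == Some r then emit s x else 0.

(* The probability, started from s, of the labeled path
   (X_1, S_1), ..., (X_n, S_n) = z. *)
Fixpoint path_prob s (z : seq (bool * state G)) : R :=
  if z is (x, r) :: z' then edge_prob s x r * path_prob r z' else 1.

(* P(X_1^{|w|} = w, S_{|w|} = t | S_0 = s) *)
Fixpoint trans_prob s w t : R :=
  if w is x :: w' then \sum_r edge_prob s x r * trans_prob r w' t
  else (s == t)%:R.

(* p_s(w) = P(X_1^{|w|} = w | S_0 = s) *)
Definition future_prob s w : R := \sum_t trans_prob s w t.

(* P(X_1^{|w|} = w, S_{|w|} = t) with S_0 ~ pi *)
Definition joint_prob w t : R := \sum_s init s * trans_prob s w t.

(* P(X_1^{|w|} = w) with S_0 ~ pi *)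
Definition word_prob w : R := \sum_t joint_prob w t.

Definition edge : rel (state G) :=
  fun s t => [exists x, (0 < emit s x) && (step s x == Some t)].

Definition stationary_vector (rho : state G -> R) : Prop :=
  [/\ forall s, 0 <= rho s,
      \sum_s rho s = 1
    & forall t, \sum_s rho s * (\sum_x edge_prob s x t) = rho t].

Definition eps_machine : Prop :=
  [/\ (0 < #|state G|)%N
      /\ (forall s, (forall x, 0 <= emit s x) /\ \sum_x emit s x = 1),
      forall s x, isSome (step s x) = (0 < emit s x),
      forall s t, connect edge s t,
      forall s t, s <> t -> exists w, future_prob s w <> future_prob t w
    & stationary_vector (@init R G)
      /\ (forall rho, stationary_vector rho -> rho = @init R G)].

Definition synchronizes_to w s : Prop :=
  0 < word_prob w /\ joint_prob w s / word_prob w = 1.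

Definition synchronizes w : Prop := exists s, synchronizes_to w s.

Definition exact : Prop := exists w, synchronizes w.

Definition L_tar : \bar R :=
  \big[maxe/0%E]_(s : state G)
    ereal_inf [set ((size w)%:R)%:E | w in [set w | synchronizes_to w s]].

Definition L_sep : \bar R :=
  \big[maxe/0%E]_(st : state G * state G | st.1 != st.2)
    ereal_inf [set ((size v)%:R)%:E |
      v in [set v | future_prob st.1 v != future_prob st.2 v]].

Definition L_syn : \bar R :=
  ereal_inf [set (k%:R)%:E | k in
    [set k : nat | forall w, size w = k -> 0 < word_prob w -> synchronizes w]].

End Generators.

Definition isomorphic (R : realType) (G G' : presentation R) : Prop :=
  exists f : state G -> state G',
    [/\ bijective f,
        forall s, init (f s) = init s,
        forall s x, emit (f s) x = emit s x
      & forall s x, 0 < emit s x -> step (f s) x = omap f (step s x)].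

(* [behead (rcons u x)] is u_2 ... u_m x, and [:: x] when m = 1. *)
Definition context_presentation (R : realType) (m : nat)
    (p pi : m.-tuple bool -> R) : presentation R :=
  {| state := m.-tuple bool;
     init := pi;
     step := fun u x => Some [tuple of behead (rcons u x)];
     emit := fun u x => if x then p u else 1 - p u |}.

(* The initial vector pi is not a parameter of a context machine: it is
   determined by the last clause of [eps_machine]. *)
Definition full_support_context (R : realType) (m : nat)
    (G : presentation R) : Prop :=
  exists p pi : m.-tuple bool -> R,
    (forall u, 0 < p u < 1) /\ G = context_presentation p pi.

(* Laws on {0,1}^Z with its product sigma-algebra. *)
Definition coordinate_events : set (set (int -> bool)) :=
  [set [set omega | omega t = x] | t in [set: int] & x in [set: bool]].

Notation bisequence := (g_sigma_algebraType coordinate_events).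

Notation process R := (probability bisequence R).

(* X_{t+1}, ..., X_{t+n} *)
Definition window (A : Type) (omega : int -> A) (t : int) (n : nat) : seq A :=
  [seq omega (t + (i.+1)%:Z) | i <- iota 0 n].

Section Processes.
Variable R : realType.
Implicit Types (P : process R) (G : presentation R).

Definition stationary P : Prop :=
  forall E : set bisequence, measurable E ->
    P [set omega | E (fun t => omega (t + 1))] = P E.

(* (X_t, S_t) has the stationary joint law of G: at every time t, S_t ~ pi and
   the subsequent symbols and states follow the dynamics of G. *)
Definition joint_realization G d (Omega : measurableType d)
    (mu : probability Omega R)
    (X : int -> Omega -> bool) (S : int -> Omega -> state G) : Prop :=
  [/\ forall t x, measurable [set o | X t o = x],
      forall t s, measurable [set o | S t o = s]
    & forall (t : int) (s : state G) (z : seq (bool * state G)),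
        mu [set o | S t o = s /\
                    window (fun i => (X i o, S i o)) t (size z) = z]
        = (init s * path_prob s z)%:E].

Definition generates G P : Prop :=
  exists d (Omega : measurableType d) (mu : probability Omega R)
         (X : int -> Omega -> bool) (S : int -> Omega -> state G),
    joint_realization mu X S /\
    (forall E : set bisequence, measurable E ->
       P E = mu [set o | E (fun t => X t o)]).

(* P(w) = P(X_1^{|w|} = w) *)
Definition word_law P (w : seq bool) : R :=
  fine (P [set omega | window omega 0 (size w) = w]).

Definition block_law P (n : nat) : n.-tuple bool -> R :=
  fun w => word_law P w.

Definition hankel P (u v : seq bool) : R := word_law P (u ++ v).

(* The rank of a possibly infinite matrix: the largest rank of its finite
   submatrices. *)
Definition has_rank (I J : Type) (H : I -> J -> R) (r : nat) : Prop :=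
  (exists (n k : nat) (f : 'I_n -> I) (g : 'I_k -> J),
     \rank (\matrix_(i < n, j < k) H (f i) (g j)) = r) /\
  (forall (n k : nat) (f : 'I_n -> I) (g : 'I_k -> J),
     (\rank (\matrix_(i < n, j < k) H (f i) (g j)) <= r)%N).

(* f is a version of the conditional probability of E given the
   sub-sigma-algebra F. *)
Definition is_cond_prob d (T : measurableType d) (P : probability T R)
    (F : set (set T)) (E : set T) (f : T -> R) : Prop :=
  [/\ forall B : set R, measurable B -> F (f @^-1` B),
      P.-integrable setT (EFin \o f)
    & forall A, F A -> (\int[P]_(o in A) (f o)%:E = P (A `&` E))%E].

(* sigma(X_t : t <= 0) *)
Definition past : set (set bisequence) :=
  <<s [set [set omega : bisequence | omega t = x]
        | t in [set t : int | t <= 0] & x in [set: bool]] >>.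

(* Some version of the conditional law of X_1 given the past is a function of
   the last k symbols X_{-k+1}, ..., X_0; by stationarity it is enough to look
   at time 1. *)
Definition depends_on_last P (k : nat) : Prop :=
  exists g : seq bool -> bool -> R, forall x : bool,
    is_cond_prob P past [set omega | omega 1 = x]
      (fun omega => g (window omega (- k%:Z) k) x).

Definition markov_order P (k : nat) : Prop :=
  depends_on_last P k /\ (forall j, depends_on_last P j -> (k <= j)%N).

(* G can serve as the machine G_P attached to the process P. *)
Definition exact_presentation G P : Prop :=
  [/\ eps_machine G, exact G & generates G P].

Definition Theta_ex (A D : nat) : set (process R) :=
  [set P | stationary P /\
     exists G, [/\ exact_presentation G P, (L_tar G <= A%:R%:E)%E
                 & (L_sep G <= D%:R%:E)%E]].

Definition uniform_identifiability (Theta : set (process R)) (T : Type)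
    (Psi : process R -> T) : Prop :=
  forall P Q, Theta P -> Theta Q -> Psi P = Psi Q ->
    forall GP GQ, exact_presentation GP P -> exact_presentation GQ Q ->
      isomorphic GP GQ.

End Processes.

Arguments block_law {R} P n.
Arguments Theta_ex {R} A D.

(* Main.v *)
Require Import Defs.
From HB Require Import structures.
From mathcomp Require Import all_boot all_order all_algebra.
From mathcomp Require Import all_classical all_reals all_analysis.
From mathcomp Require Import measurable_realfun.
From mathcomp Require Import zify ring lra.
Set Implicit Arguments.
Unset Strict Implicit.
Unset Printing Implicit Defensive.
Import Order.TTheory GRing.Theory Num.Theory.
Local Open Scope classical_set_scope.
Local Open Scope ring_scope.

(* Take p_{0v} + p_{1v} = 1 for every word v of length m - 1. Then each state
   vx of the context machine receives total mass one from its two predecessors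
   0v and 1v, so the stationary vector is uniform and P_m is uniform whatever
   the remaining freedom in p, whereas P_{m+1}(u1) = 2^-m p_u recovers p. If
   moreover the p_u are pairwise distinct, single letters separate the states
   and the one-step matrix splits into invertible 2 x 2 blocks, which gives the
   Hankel rank. Two such choices of p yield the two machines.

   The processes themselves come from Lebesgue measure on [0, 1[: any family
   q(w) with q(w) = q(w0) + q(w1) = q(0w) + q(1w) is the window law of a process
   on the integers, obtained by cutting [0, 1[ into nested intervals of lengths
   q(w), the words growing alternately to the right and to the left. *)

(** * Construction of stationary binary processes *)

Section Windows.
Variable A : Type.
Implicit Types (omega : int -> A) (t : int).

Lemma size_window omega t n : size (window omega t n) = n.
Proof. by rewrite size_map size_iota. Qed.

Lemma window_cons omega t n :
  window omega t n.+1 = omega (t + 1) :: window omega (t + 1) n.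
Proof.
rewrite /window /= (iotaDl 1 0) -map_comp; congr cons.
by apply: eq_map => i /=; congr omega; lia.
Qed.

Lemma window_cat omega t m n :
  window omega t (m + n) = window omega t m ++ window omega (t + m%:Z) n.
Proof.
elim: m t => [|m IHm] t; first by rewrite addr0.
by rewrite addSn !window_cons IHm /=; congr (_ :: _ ++ window _ _ _); lia.
Qed.

Lemma window_rcons omega t n :
  window omega t n.+1 = rcons (window omega t n) (omega (t + n.+1%:Z)).
Proof.
rewrite -addn1 window_cat cats1 /window /=; congr (rcons _ (omega _)); lia.
Qed.

Lemma window_shift omega t n c :
  window (fun i => omega (i + c)) t n = window omega (t + c) n.
Proof. by apply: eq_map => i; congr omega; lia. Qed.

End Windows.

(* Words are stacks here: the last digit is at the head. *)
Section Digits.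
Variables (R : realType) (q : seq bool -> R).
Hypotheses (q_ge0 : forall w, 0 <= q w) (q_nil : q [::] = 1).
Hypothesis q_split : forall w, q w = q (false :: w) + q (true :: w).

(* The interval of w is [lower w, lower w + q w[; the two children of w cut it
   into consecutive pieces. *)
Fixpoint lower (w : seq bool) : R :=
  if w is x :: w' then lower w' + (if x then q (false :: w') else 0) else 0.

Fixpoint digits (u : R) (n : nat) : seq bool :=
  if n is n'.+1 then
    let d := digits u n' in (lower d + q (false :: d) <= u) :: d
  else [::].

Lemma size_digits u n : size (digits u n) = n.
Proof. by elim: n => //= n ->. Qed.

Lemma lower_bounds w : 0 <= lower w /\ lower w + q w <= 1.
Proof.
elim: w => [|x w [l0 l1]] /=; first by rewrite q_nil; split; lra.
have := q_split w; have := q_ge0 (false :: w); have := q_ge0 (true :: w).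
by case: x; split; lra.
Qed.

(** The two children of [w] cut its interval into disjoint pieces, and nonnegativity of [q] keeps
    them inside it: a point whose address already departs from [w] stays outside the intervals of
    all extensions of [w]. *)
Lemma digitsE u w : 0 <= u < 1 ->
  (digits u (size w) == w) = (lower w <= u < lower w + q w).
Proof.
move=> u01; elim: w => [|x w IHw]; first by rewrite /= q_nil add0r eqxx u01.
rewrite /= eqseq_cons; case: eqP IHw => [-> IHw|_ IHw].
  rewrite andbT; have := q_split w.
  have := q_ge0 (false :: w); have := q_ge0 (true :: w).
  move: IHw; case: x => /= IHw qt qf qw.
    by rewrite eqb_id; lra.
  by rewrite eqbF_neg addr0 -ltNge; lra.
rewrite andbF; have := q_split w.
have := q_ge0 (false :: w); have := q_ge0 (true :: w).
by move: IHw; case: x => /= IHw qt qf qw; apply/esym/negbTE; lra.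
Qed.

Lemma measurable_digits n w : measurable [set u : R | digits u n = w].
Proof.
elim: n w => [|n IHn] w.
  case: w => [|x w]; last by rewrite (_ : mkset _ = set0) //; apply/seteqP; split.
  by rewrite (_ : mkset _ = setT) //; apply/seteqP; split.
case: w => [|x w]; first by rewrite (_ : mkset _ = set0) //; apply/seteqP; split.
have mc : measurable [set u : R | lower w + q (false :: w) <= u].
  by rewrite -set_itvcy; exact: measurable_itv.
rewrite (_ : mkset _ = [set u : R | digits u n = w] `&`
  (if x then [set u : R | lower w + q (false :: w) <= u]
   else ~` [set u : R | lower w + q (false :: w) <= u])).
  by apply: measurableI => //; case: x => //; exact: measurableC.
apply/seteqP; split=> u /=.
  by case=> h dw; split=> //; move: h; rewrite dw; case: x => [|/negbT/negP].
by case=> ->; case: x => [->|/negP/negbTE ->].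
Qed.

End Digits.

Lemma measure_partition d (T : measurableType d) (R : realType)
    (mu : {measure set T -> \bar R}) (I : finType) (S : T -> I) (A : set T) :
  measurable A -> (forall i, measurable [set o | S o = i]) ->
  mu A = (\sum_i mu (A `&` [set o | S o = i]))%E.
Proof.
move=> mA mS; rewrite {1}(_ : A =
  \bigcup_(i in [set` enum I]) (A `&` [set o | S o = i])).
  rewrite measure_fin_bigcup //.
  - by rewrite -fsbig_seq ?enum_uniq // big_enum.
  - by move=> i j _ _ [y [[_ <-] [_ <-]]].
  - by move=> i _; apply: measurableI.
by apply/seteqP; split=> [y Ay|y [i _ []] //]; exists (S y) => //=; rewrite mem_enum.
Qed.

Lemma measurable_coordinate (t : int) x :
  measurable ([set omega | omega t = x] : set bisequence).
Proof. by apply: sub_sigma_algebra; exists t => //; exists x. Qed.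

(** Measurability is required only at the coordinates that the window reads, so that the lemma also
    applies to the sigma-algebra of the past. *)
Lemma measurable_window d (T : measurableType d) (A : Type) (X : int -> T -> A)
    t n w :
  (forall i x, t < i <= t + n%:Z -> measurable [set o | X i o = x]) ->
  measurable [set o | window (fun i => X i o) t n = w].
Proof.
elim: n t w => [|n IHn] t [|x w] mX.
- by rewrite (_ : mkset _ = setT) //; apply/seteqP; split.
- by rewrite (_ : mkset _ = set0) //; apply/seteqP; split.
- by rewrite (_ : mkset _ = set0) //; apply/seteqP; split=> // o /=; rewrite window_cons.
rewrite (_ : mkset _ = [set o | X (t + 1) o = x] `&`
  [set o | window (fun i => X i o) (t + 1) n = w]).
  apply: measurableI; first by apply: mX; lia.
  by apply: IHn => i y ti; apply: mX; lia.
by apply/seteqP; split=> o; rewrite /= window_cons; case=> -> ->.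
Qed.

Lemma measurable_window_event t n w :
  measurable [set om : bisequence | window om t n = w].
Proof.
apply: (@measurable_window _ bisequence _ (fun t om => om t)) => i x _.
exact: measurable_coordinate.
Qed.

(** * Lebesgue measure on [0, 1[ as a probability *)

Section UnitInterval.
Variable R : realType.

Let munit : measurable ([set` `[0, 1[%R] : set (measurableTypeR R)).
Proof. exact: measurable_itv. Qed.

Definition lebesgue_unit : set (measurableTypeR R) -> \bar R :=
  mrestr lebesgue_measure munit.

HB.instance Definition _ := 
  Measure.copy lebesgue_unit (mrestr lebesgue_measure munit).

Let lebesgue_unit_setT : lebesgue_unit setT = 1%E.
Proof.
by rewrite /lebesgue_unit /mrestr setTI lebesgue_measure_itv /= lte_fin ltr01 sube0.
Qed.

HB.instance Definition _ :=
  Measure_isProbability.Build _ _ _ lebesgue_unit lebesgue_unit_setT.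

Lemma lebesgue_unitE (A : set (measurableTypeR R)) (a b : R) :
  0 <= a -> b <= 1 -> a <= b ->
  (forall u : R, 0 <= u < 1 -> A u <-> a <= u < b) -> lebesgue_unit A = (b - a)%:E.
Proof.
move=> a0 b1 ab HA; rewrite /lebesgue_unit /mrestr.
rewrite (_ : _ `&` _ = [set` `[a, b[%R]).
  rewrite lebesgue_measure_itv /= lte_fin; case: ltP => // ba.
  by rewrite (_ : b = a) ?subrr //; apply/eqP; rewrite eq_le ba ab.
apply/seteqP; split=> u /=; rewrite !in_itv /=.
  by case=> Au u01; apply/(HA u u01).
move=> uab; have u01 : 0 <= u < 1 by lra.
by split=> //; apply/(HA u u01); exact: uab.
Qed.

End UnitInterval.

(* Digits 0, 1, 2, 3, ... sit at the coordinates 0, -1, 1, -2, ... *)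
Fixpoint spread (d : seq bool) : seq bool :=
  if d is x :: d' then
    if odd (size d') then x :: spread d' else rcons (spread d') x
  else [::].

(** Index of the digit read at coordinate [t]; [Negz n] stands for -(n + 1). *)
Definition position (t : int) : nat :=
  match t with Posz n => n.*2 | Negz n => n.*2.+1 end.

Lemma size_spread d : size (spread d) = size d.
Proof. by elim: d => //= x d IHd; case: ifP; rewrite /= ?size_rcons IHd. Qed.

Lemma spread_surj v : exists2 d, size d = size v & spread d = v.
Proof.
elim: (size v) {-2}v (erefl (size v)) => {v} [|n IHn] v sv.
  by exists [::]; move: sv; case: v.
case: (boolP (odd n)) => nodd.
  case: v sv => // x v [sv]; have [d sd <-] := IHn v sv.
  by exists (x :: d); rewrite /= ?size_spread ?sd ?sv ?nodd.
case/lastP: v sv => // v x; rewrite size_rcons => -[sv].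
have [d sd dv] := IHn v sv.
by exists (x :: d); rewrite /= ?size_rcons ?sd ?sv ?(negbTE nodd) ?dv.
Qed.

Lemma spread_inj d d' : size d = size d' -> spread d = spread d' -> d = d'.
Proof.
elim: d d' => [|x d IHd] [|y d'] //= [sd]; rewrite sd.
case: ifP => _; first by case=> -> /(IHd _ sd) ->.
by move=> /rcons_inj[/(IHd _ sd) -> ->].
Qed.

Section StationaryBinaryProcess.
Variables (R : realType) (q : seq bool -> R).
Hypotheses (q_ge0 : forall w, 0 <= q w) (q_nil : q [::] = 1).
Hypothesis q_rcons : forall w, q w = q (rcons w false) + q (rcons w true).
Hypothesis q_cons : forall w, q w = q (false :: w) + q (true :: w).

Let qd d := q (spread d).

(** Both consistency conditions on [q] enter here: a new digit goes to the left when the length is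
    odd ([q_cons]) and to the right when it is even ([q_rcons]). *)
Let qd_split d : qd d = qd (false :: d) + qd (true :: d).
Proof. by rewrite /qd /=; case: ifP. Qed.

Let omega (u : measurableTypeR R) : bisequence :=
  fun t => head false (digits qd u (position t).+1).

(** The first 2N digits fill exactly the coordinates -N, ..., N - 1; the next two extend this block
    by one on each side. *)
Let spread_digits u N :
  spread (digits qd u N.*2) = window (omega u) (- N%:Z - 1) N.*2.
Proof.
elim: N => [|N IHN] //.
rewrite doubleS window_cons (_ : - N.+1%:Z - 1 + 1 = - N%:Z - 1); last lia.
rewrite window_rcons -IHN.
rewrite (_ : - N%:Z - 1 + N.*2.+1%:Z = Posz N); last lia.
rewrite (_ : - N%:Z - 1 = Negz N); last by rewrite NegzE; lia.
by rewrite /= !size_digits /= odd_double.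
Qed.

Let measurable_omega : measurable_fun setT omega.
Proof.
apply: (@measurability _ _ (measurableTypeR R) bisequence setT omega
  coordinate_events) => //.
move=> _ [_ [t _ [x _ <-]] <-].
(* The union runs over the countable type of all words; those of the wrong length contribute the
   empty set. *)
rewrite setTI (_ : _ @^-1` _ = \bigcup_(w in [set w | head false w = x])
  [set u | digits qd u (position t).+1 = w]).
  rewrite bigcup_mkcond; apply: countable_bigcupT_measurable => // w.
  by case: ifP => // _; exact: measurable_digits.
apply/seteqP; split=> u /=; last by case=> w <- <-.
by move=> <-; exists (digits qd u (position t).+1).
Qed.

(** Lebesgue measure is pushed forward along [omega]. Central windows of even length have the law
    [q] by construction; any other window lies in a central one, and the extra coordinates are
    summed out. *)
Lemma stationary_binary_process : exists P : process R,
  forall t w, P [set om : bisequence | window om t (size w) = w] = (q w)%:E.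
Proof.
pose X : {mfun measurableTypeR R >-> bisequence} :=
  mfun_Sub (mem_set measurable_omega).
pose P : process R := distribution (@lebesgue_unit R) X.
exists P.
have central N w : size w = N.*2 ->
  P [set om : bisequence | window om (- N%:Z - 1) (size w) = w] = (q w)%:E.
  move=> sw; have [d sd <-] := spread_surj w.
  rewrite size_spread -(addrK (lower qd d) (q (spread d))) (addrC (q _)).
  have [l0 l1] := lower_bounds (fun d => q_ge0 (spread d)) q_nil qd_split d.
  apply: lebesgue_unitE => //; first by rewrite lerDl.
  move=> u u01; rewrite -(digitsE (fun d => q_ge0 (spread d)) q_nil qd_split) //.
  rewrite /= sd sw -spread_digits; split; last by move/eqP => ->.
  by move=> h; apply/eqP/spread_inj => //; rewrite size_digits sd.
(* [good t n] passes to shorter windows: the last coordinate is summed out with [q_rcons], the first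
   with [q_cons]. *)
clearbody P; pose good t n := forall w, size w = n ->
  P [set om : bisequence | window om t (size w) = w] = (q w)%:E.
have mwin := measurable_window_event.
have shrinkr t n : good t n.+1 -> good t n.
  move=> gt w sw.
  rewrite (measure_partition P (S := fun om : bisequence => om (t + n.+1%:Z))) //.
    rewrite big_bool /= q_rcons addrC EFinD; congr (_ + _)%E.
      rewrite -gt ?size_rcons ?sw //. congr (P _).
      apply/seteqP; split=> om /=; rewrite window_rcons.
        by case=> -> ->.
      by move/rcons_inj => [-> ->].
    rewrite -gt ?size_rcons ?sw //; congr (P _).
    apply/seteqP; split=> om /=; rewrite window_rcons.
      by case=> -> ->.
    by move/rcons_inj => [-> ->].
  by move=> x; exact: measurable_coordinate.
have shrinkl t n : good t n.+1 -> good (t + 1) n.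
  move=> gt w sw.
  rewrite (measure_partition P (S := fun om : bisequence => om (t + 1))) //.
    rewrite big_bool /= q_cons addrC EFinD; congr (_ + _)%E.
      rewrite -gt /= ?sw //; congr (P _).
      by apply/seteqP; split=> om /=; rewrite window_cons; case=> -> ->.
    rewrite -gt /= ?sw //; congr (P _).
    by apply/seteqP; split=> om /=; rewrite window_cons; case=> -> ->.
  by move=> x; exact: measurable_coordinate.
have shrinkrs t n k : good t (n + k)%N -> good t n.
  by elim: k => [|k IHk]; rewrite ?addn0 // addnS => /shrinkr/IHk.
have shrinkls t n k : good t (n + k)%N -> good (t + k%:Z) n.
  elim: k t => [|k IHk] t; first by rewrite addn0 addr0.
  by rewrite addnS => /shrinkl/IHk; rewrite (_ : t + 1 + k%:Z = t + k.+1%:Z) //; lia.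
(* [N] is large enough for the coordinates -N, ..., N - 1 to contain the window, and [k] is the
   distance between the two left ends. *)
move=> t w; pose N := (absz t + size w).+1; pose k := absz (t + N%:Z + 1).
have -> : t = - N%:Z - 1 + k%:Z by lia.
apply: (shrinkls _ (size w)) => //.
apply: (shrinkrs _ _ (N.*2 - (size w + k))%N).
rewrite subnKC; last by lia.
by move=> v; apply: central.
Qed.

End StationaryBinaryProcess.

(** * Processes determined by their window laws *)

Lemma nth_window (A : Type) (x0 : A) (omega : int -> A) t n i : (i < n)%N ->
  nth x0 (window omega t n) i = omega (t + i.+1%:Z).
Proof. by move=> ltin; rewrite (nth_map 0%N) ?size_iota // nth_iota. Qed.

(* Windows from - n + 1 to b n: the past for b = 0, everything for b = 1. A word
   of the wrong length gives the empty event, which makes this class stable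
   under intersection. *)
Definition window_events (b : nat) : set (set bisequence) :=
  [set E | exists n (w : seq bool),
    E = [set om : bisequence | window om (- n%:Z) (n + b * n) = w]].

Lemma window_events_measurable b : window_events b `<=` measurable.
Proof. by move=> _ [n [w ->]]; exact: measurable_window_event. Qed.

Lemma window_events_setT b : window_events b setT.
Proof.
exists 0%N, [::]; apply/seteqP; split=> om //= _.
by apply/size0nil; rewrite size_window muln0.
Qed.

Lemma window_nested (om : int -> bool) b n n' : (n <= n')%N ->
  window om (- n%:Z) (n + b * n) =
  take (n + b * n) (drop (n' - n) (window om (- n'%:Z) (n' + b * n'))).
Proof.
move=> len; have -> : (n' + b * n' = n' - n + (n + b * n + b * (n' - n)))%N by nia.
rewrite (window_cat _ _ (n' - n)) drop_size_cat ?size_window //.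
rewrite (window_cat _ _ (n + b * n)) take_size_cat ?size_window //.
congr window; lia.
Qed.

Lemma drop_window (om : int -> bool) n n' : (n <= n')%N ->
  window om (- n%:Z) n = drop (n' - n) (window om (- n'%:Z) n').
Proof.
move=> /(window_nested om 0); rewrite !mul0n !addn0 => ->.
by rewrite take_oversize // size_drop size_window; lia.
Qed.

(** The longer window contains the shorter one. The intersection is thus the event of the longer
    word if the two words are compatible; otherwise it is empty, and is represented by a word one
    letter too long. *)
Lemma window_events_setI b : setI_closed (window_events b).
Proof.
move=> _ _ [n [w ->]] [n' [w' ->]].
wlog len : n w n' w' / (n <= n')%N => [hw|].
  by case: (leqP n n') => [|/ltnW] /hw //; rewrite setIC; apply.
exists n', (if take (n + b * n) (drop (n' - n) w') == w then w'
            else nseq (n' + b * n').+1 true).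
apply/seteqP; split=> om /=; rewrite (window_nested om b len).
  by case=> <- <-; rewrite eqxx.
case: eqP => [ww ->|_ /(congr1 size)]; first by rewrite ww.

by rewrite [size (_ :: _)]/= size_window size_nseq => /n_Sn.
Qed.

(** The condition on [t] reads [t <= 0] for b = 0 and holds at every [t] for b = 1, which covers the
    past and the full sigma-algebra at once. *)
Lemma window_events_coordinate b (t : int) x : t <= b%:Z * `|t| ->
  <<s window_events b >> [set om | om t = x].
Proof.
move=> tb; pose n := (absz t).+1; pose i := absz (t + (absz t)%:Z).
rewrite (_ : mkset _ = \bigcup_(w in [set w | nth false w i = x])
   [set om : bisequence | window om (- n%:Z) (n + b * n) = w]).
  rewrite bigcup_mkcond; pose T := g_sigma_algebraType (window_events b).
  apply: (@countable_bigcupT_measurable _ T) => // w.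
  case: ifP => _; last exact: sigma_algebra0.
  by apply: sub_sigma_algebra; exists n, w.
have hi (om : bisequence) : nth false (window om (- n%:Z) (n + b * n)) i = om t.
  by rewrite nth_window; [congr om; lia|nia].
apply/seteqP; split=> om /=; first by rewrite -hi => h; eexists; first exact: h.
by case=> w /= <- <-; rewrite hi.
Qed.

Lemma measurable_window_events : measurable `<=` <<s window_events 1 >>.
Proof.
apply: smallest_sub; first exact: smallest_sigma_algebra.
move=> _ [t _ [x _ <-]]; apply: window_events_coordinate; lia.
Qed.

Lemma past_window_events : past `<=` <<s window_events 0 >>.
Proof.
apply: smallest_sub; first exact: smallest_sigma_algebra.
move=> _ [t /= t0 [x _ <-]]; apply: window_events_coordinate; lia.
Qed.

Lemma past_measurable : past `<=` (measurable : set (set bisequence)).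
Proof.
apply: smallest_sub; first exact: sigma_algebra_measurable.
by move=> _ [t _ [x _ <-]]; exact: measurable_coordinate.
Qed.

Lemma past_window n w : past [set om : bisequence | window om (- n%:Z) n = w].
Proof.
apply: (@measurable_window _ (g_sigma_algebraType
  [set [set omega : bisequence | omega t = x]
    | t in [set t : int | t <= 0] & x in [set: bool]]) _ (fun t om => om t)).
by move=> i x ti; apply: sub_sigma_algebra; exists i; [move=> /=; lia|exists x].
Qed.

(** Uniqueness of measures on a pi-system. It is stated for finite measures rather than
    probabilities because it is also applied to restricted and rescaled ones. *)
Lemma window_events_unique (R : realType) b
    (m1 m2 : {measure set bisequence -> \bar R}) :
  (m1 setT < +oo)%E ->
  (forall n (w : seq bool),
    m1 [set om : bisequence | window om (- n%:Z) (n + b * n) = w] =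
    m2 [set om : bisequence | window om (- n%:Z) (n + b * n) = w]) ->
  forall E, <<s window_events b >> E -> m1 E = m2 E.
Proof.
move=> m1T m12 E bE.
apply: (g_sigma_algebra_measure_unique (window_events b) _ (fun _ => setT)) => //.
- exact: window_events_measurable.
- by move=> _; exact: window_events_setT.
- by apply/seteqP; split=> // om _; exists 0%N.
- exact: window_events_setI.
- by move=> _ [n [w ->]].
Qed.

(** * Integrals of functions with finitely many values *)

Section FiniteRange.
Local Open Scope ereal_scope.
Context d (T : measurableType d) (R : realType) (mu : {measure set T -> \bar R}).
Variables (I : finType) (S : T -> I) (h : I -> R).
Hypothesis mS : forall i, measurable [set y | S y = i].

Let hE y : (h (S y))%:E = \sum_i (h i)%:E * (\1_[set y | S y = i] y)%:E.
Proof.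
rewrite (bigD1 (S y)) //= indicE mem_set // mule1 big1 ?adde0 // => i /eqP Si.
by rewrite indicE memNset ?mule0 // => /esym.
Qed.

Lemma integrable_finite_range : mu setT < +oo ->
  mu.-integrable setT (EFin \o (h \o S)).
Proof.
move=> fin; rewrite (_ : _ \o _ =
  fun y => \sum_i (h i)%:E * (\1_[set y | S y = i] y)%:E); last first.
  by apply/funext => y; rewrite /= hE.
apply: integrable_sum => // i _; apply: integrableZl => //.
apply: measurable_bounded_integrable => //.
by exists 1%R; split=> // r r1 y _ /=; rewrite /indic; case: (_ \in _);
  rewrite ?normr1 ?normr0; apply/ltW => //; apply: lt_trans r1.
Qed.

Lemma integral_finite_range A : measurable A -> (forall i, 0 <= h i)%R ->
  \int[mu]_(y in A) (h (S y))%:E = \sum_i (h i)%:E * mu (A `&` [set y | S y = i]).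
Proof.
move=> mA h0; under eq_integral do rewrite hE.
rewrite ge0_integral_sum //.
- apply: eq_bigr => i _; rewrite ge0_integralZl_EFin //.
    by rewrite integral_indic // setIC.
  exact/measurable_EFinP.
- by move=> i; apply: measurable_funeM; exact/measurable_EFinP.
- by move=> i y _; rewrite mule_ge0 ?lee_fin.
Qed.

End FiniteRange.

Section WindowLaw.
Variables (R : realType) (P : process R) (q : seq bool -> R).
Hypothesis Pq : forall t (w : seq bool),
  P [set om : bisequence | window om t (size w) = w] = (q w)%:E.

(** The law [q] of a window does not depend on its position, so [P] and its shift agree on the
    pi-system of central windows. *)
Lemma window_law_stationary : stationary P.
Proof.
have mshift : measurable_fun [set: bisequence]
    (fun om : bisequence => (fun t => om (t + 1)) : bisequence).
  apply: (@measurability _ _ bisequence bisequence _ _ coordinate_events) => //.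
  move=> _ [_ [t _ [x _ <-]] <-].
  by rewrite setTI; exact: (measurable_coordinate (t + 1) x).
pose shift : {mfun bisequence >-> bisequence} := mfun_Sub (mem_set mshift).
move=> E mE; apply: (@window_events_unique _ 1 (distribution P shift) P) => //.
- by rewrite [X in (X < _)%E](_ : _ = 1%E) ?ltry //; exact: probability_setT.
- move=> n w; rewrite -[LHS]/(P (shift @^-1`
    [set om : bisequence | window om (- n%:Z) (n + 1 * n) = w])).
  rewrite (_ : _ @^-1` _ =
    [set om : bisequence | window om (- n%:Z + 1) (n + 1 * n) = w]); last first.
    by apply/seteqP; split=> om /=; rewrite window_shift; apply.
  have [sw|sw] := eqVneq (size w) (n + 1 * n)%N.
  by rewrite -sw Pq; apply/esym; exact: Pq.
  by apply: (congr1 P); apply/seteqP; split=> om /= h; move: sw;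
    rewrite -h size_window eqxx.
- exact: measurable_window_events.
Qed.

Let Pq_next t (v : seq bool) x :
  P ([set om : bisequence | window om t (size v) = v] `&`
     [set om | om (t + (size v).+1%:Z) = x]) = (q (rcons v x))%:E.
Proof.
rewrite -(Pq t) size_rcons; apply: (congr1 P); apply/seteqP; split=> om /=;
  rewrite window_rcons; first by case=> -> ->.
by move=> /rcons_inj[].
Qed.

(** * Finite memory and the conditional law given the past *)

Section Markov.
Variables (k : nat) (g : seq bool -> bool -> R).
Hypothesis g_ge0 : forall v x, 0 <= g v x.
Hypothesis q_next : forall u v x, size v = k ->
  q (u ++ rcons v x) = g v x * q (u ++ v).

Let last_k (om : bisequence) : k.-tuple bool :=
  Tuple (introT eqP (size_window om (- k%:Z) k)).

Let last_kE (v : k.-tuple bool) : [set om | last_k om = v] =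
  [set om : bisequence | window om (- k%:Z) k = v].
Proof.
by apply/seteqP; split=> om /= h; [rewrite -h|exact: val_inj].
Qed.

(** For fixed [x] and [v] both sides are finite measures in [A]. By [q_next] they agree on the
    windows ending at time 0, hence on the whole past. *)
Let cond_past x (v : k.-tuple bool) A : past A ->
  P (A `&` [set om | om 1 = x] `&` [set om | last_k om = v]) =
  ((g v x)%:E * P (A `&` [set om | last_k om = v]))%E.
Proof.
move=> /past_window_events pA; rewrite last_kE.
have mC : measurable [set om : bisequence | window om (- k%:Z) k = v].
  exact: measurable_window_event.
have mD : measurable ([set om : bisequence | om 1 = x] `&`
    [set om : bisequence | window om (- k%:Z) k = v]).
  by apply: measurableI => //; exact: measurable_coordinate.
rewrite -setIA.
pose gv : {nonneg R} := NngNum (g_ge0 v x).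
apply: (@window_events_unique _ 0 (mrestr P mD) (mscale gv (mrestr P mC))) => //.
  by apply: le_lt_trans (ltry 1); apply: probability_le1; exact: measurableI.
move=> n w; rewrite mul0n addn0.
rewrite -[LHS]/(P ([set om : bisequence | window om (- n%:Z) n = w] `&`
   ([set om : bisequence | om 1 = x] `&`
    [set om : bisequence | window om (- k%:Z) k = v]))).
rewrite -[RHS]/((g v x)%:E * P ([set om : bisequence | window om (- n%:Z) n = w] `&`
    [set om : bisequence | window om (- k%:Z) k = v]))%E.
rewrite (setIC [set om | om 1 = x]) setIA.
have step u : P ([set om : bisequence |
      window om (- (size (u ++ v))%:Z) (size (u ++ v)) = u ++ v] `&`
    [set om | om 1 = x]) = ((g v x)%:E * P [set om : bisequence |
      window om (- (size (u ++ v))%:Z) (size (u ++ v)) = u ++ v])%E.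
  rewrite Pq -EFinM -q_next ?size_tuple // -rcons_cat -(Pq_next (- (size (u ++ v))%:Z)).
  by congr (P (_ `&` _)); apply/seteqP; split=> om /= <-; congr om; lia.
set V := [set om | window om (- k%:Z) k = v] in mC mD *.
set W := [set om | window om (- n%:Z) n = w].
(* Both windows end at time 0, so one contains the other: the intersection is empty or prescribes a
   single word ending in [v]. *)
have [->|[u ->]] : W `&` V = set0 \/ exists u, W `&` V = [set om : bisequence |
    window om (- (size (u ++ v))%:Z) (size (u ++ v)) = u ++ v].
- have [lekn|/ltnW lenk] := leqP k n.
    have [wv|wv] := eqVneq (drop (n - k) w) v; last first.
      left; apply/seteqP; split=> om //= [Ww Vv]; move: wv.
      by rewrite -Ww -drop_window // Vv eqxx.
    have [sw|sw] := eqVneq (size w) n; last first.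
      left; apply/seteqP; split=> om //= [Ww _]; move: sw.
      by rewrite -Ww size_window eqxx.
    right; exists (take (n - k) w).
    rewrite -wv cat_take_drop sw; apply/seteqP; split=> om /= => [[]|Ww] //.
    by split=> //; rewrite /V /= (drop_window om lekn) Ww.
  have [vw|vw] := eqVneq (drop (k - n) v) w; last first.
    left; apply/seteqP; split=> om //= [Ww Vv]; move: vw.
    by rewrite -Vv -drop_window // Ww eqxx.
  right; exists [::]; rewrite /= size_tuple.
  apply/seteqP; split=> om /= => [[]|Vv] //.
  by split=> //; rewrite /W /= (drop_window om lenk) Vv.
- by rewrite set0I measure0 mule0.
- exact: step.
Qed.

(** The proposed version takes finitely many values, one for each word of the last [k] symbols; its
    averaging identity is [cond_past] summed over these words. *)
Lemma window_law_depends : depends_on_last P k.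
Proof.
exists g => x; split.
- move=> B mB.
  pose T := g_sigma_algebraType [set [set omega : bisequence | omega t = y]
    | t in [set t : int | t <= 0] & y in [set: bool]].
  rewrite (_ : _ @^-1` _ = \bigcup_(v in [set v | B (g v x)])
    [set om : bisequence | window om (- k%:Z) k = v]); last first.
    by apply/seteqP; split=> om /= => [Bom|[v Bv ->]] //; eexists; first exact: Bom.
  rewrite bigcup_mkcond; apply: (@countable_bigcupT_measurable _ T) => // v.
  by case: ifP => _; [exact: past_window|exact: sigma_algebra0].
- apply: (integrable_finite_range (S := last_k) (fun v => g v x)); last first.
    by rewrite [X in (X < _)%E](_ : _ = 1%E) ?ltry //; exact: probability_setT.
  by move=> v; rewrite last_kE; exact: measurable_window_event.
- move=> A pA; have mA := past_measurable pA.
  have mlast v : measurable [set om | last_k om = v].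
    by rewrite last_kE; exact: measurable_window_event.
  rewrite (integral_finite_range P (S := last_k) (h := fun v => g v x)) //.
  rewrite [RHS](measure_partition P (S := last_k)) //.
    by apply: eq_bigr => v _; apply/esym; exact: cond_past.
  by apply: measurableI => //; exact: measurable_coordinate.
Qed.

End Markov.

(** The version of the conditional probability is constant on the past window [v], which is at least
    as long as the memory. Integrating over that event turns an almost sure statement into an
    identity between word probabilities. *)
Lemma depends_on_last_next (m j : nat) : (j <= m)%N -> depends_on_last P j ->
  exists g : seq bool -> bool -> R, forall v x, size v = m ->
    q (rcons v x) = g (drop (m - j) v) x * q v.
Proof.
move=> lejm [g gP]; exists g => v x sv.
have [_ _ /(_ _ (past_window (size v) v))] := gP x.
rewrite (eq_integral (cst (g (drop (m - j) v) x)%:E)); last first.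
  move=> om; rewrite inE /= sv => <-; congr (g _ x)%:E.
  exact: drop_window.
rewrite integral_cst; last exact: measurable_window_event.
move=> h; apply/esym/EFin_inj.
rewrite EFinM -(Pq_next (- (size v)%:Z)) -(Pq (- (size v)%:Z)); apply: (etrans h).
by congr (P (_ `&` _)); apply/seteqP; split=> om /= <-; congr om; lia.
Qed.

End WindowLaw.

(** * Presentations and the processes they generate *)

Section Presentations.
Variables (R : realType) (G : presentation R).
Implicit Types (s t r : state G) (x : bool) (w v : seq bool).

Lemma future_prob_nil s : future_prob s [::] = 1.
Proof.
rewrite /future_prob (bigD1 s) //= eqxx big1 ?addr0 // => t /negbTE.
by rewrite eq_sym => ->.
Qed.

Lemma future_prob_cons s x w :
  future_prob s (x :: w) = \sum_r edge_prob s x r * future_prob r w.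
Proof.
rewrite /future_prob /= exchange_big; apply: eq_bigr => r _.
by rewrite mulr_sumr.
Qed.

Lemma trans_prob_cat s u v t :
  trans_prob s (u ++ v) t = \sum_r trans_prob s u r * trans_prob r v t.
Proof.
elim: u s => [|x u IHu] s /=.
  rewrite (bigD1 s) //= eqxx mul1r big1 ?addr0 // => r /negbTE.
  by rewrite eq_sym => ->; rewrite mul0r.
under [RHS]eq_bigr do rewrite mulr_suml.
rewrite exchange_big; apply: eq_bigr => r _; rewrite IHu mulr_sumr.
by apply: eq_bigr => r' _; rewrite mulrA.
Qed.

Lemma trans_prob1 s x t : trans_prob s [:: x] t = edge_prob s x t.
Proof.
rewrite /= (bigD1 t) //= eqxx mulr1 big1 ?addr0 // => r /negbTE ->.
by rewrite mulr0.
Qed.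

Lemma joint_prob_nil t : joint_prob [::] t = init t.
Proof.
rewrite /joint_prob (bigD1 t) //= eqxx mulr1 big1 ?addr0 // => s /negbTE ->.
by rewrite mulr0.
Qed.

Lemma joint_prob_cat u v t :
  joint_prob (u ++ v) t = \sum_r joint_prob u r * trans_prob r v t.
Proof.
rewrite /joint_prob; under [RHS]eq_bigr do rewrite mulr_suml.
rewrite exchange_big; apply: eq_bigr => s _; rewrite trans_prob_cat mulr_sumr.
by apply: eq_bigr => r _; rewrite mulrA.
Qed.

Lemma joint_prob_rcons u x t :
  joint_prob (rcons u x) t = \sum_r joint_prob u r * edge_prob r x t.
Proof.
rewrite -cats1 joint_prob_cat //; apply: eq_bigr => r _.
by rewrite trans_prob1.
Qed.

Lemma word_prob_cat u v :
  word_prob G (u ++ v) = \sum_(r : state G) joint_prob u r * future_prob r v.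
Proof.
rewrite /word_prob; under eq_bigr do rewrite joint_prob_cat //.
by rewrite exchange_big; apply: eq_bigr => r _; rewrite /future_prob mulr_sumr.
Qed.

Lemma word_probE w : word_prob G w = \sum_(s : state G) init s * future_prob s w.
Proof.
rewrite (word_prob_cat [::]); apply: eq_bigr => s _.
by rewrite joint_prob_nil.
Qed.

Lemma path_prob_rcons s z x r :
  path_prob s (rcons z (x, r)) =
  path_prob s z * edge_prob (last s (unzip2 z)) x r.
Proof.
elim: z s => [|[y t] z IHz] s /=; first by rewrite mulr1 mul1r.
by rewrite IHz mulrA.
Qed.

(** * Word probabilities in a realization of the joint law *)

Section Realization.
Variables (d : measure_display) (Omega : measurableType d).
Variables (mu : probability Omega R).
Variables (X : int -> Omega -> bool) (S : int -> Omega -> state G).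
Hypothesis XS : joint_realization mu X S.

Let mX (t : int) x : measurable [set o | X t o = x]. Proof. by case: XS. Qed.
Let mS (t : int) s : measurable [set o | S t o = s]. Proof. by case: XS. Qed.

Let mXS n z (t : int) :
  measurable [set o | window (fun i => (X i o, S i o)) t n = z].
Proof.
apply: (@measurable_window _ _ _ (fun i o => (X i o, S i o))) => i [x s] _.
rewrite (_ : mkset _ = [set o | X i o = x] `&` [set o | S i o = s]).
  exact: measurableI.
by apply/seteqP; split=> o /= [-> ->].
Qed.

(** A known labeled path [z] is followed by a word [w] with unobserved states. The induction moves
    the letters of [w] one by one into [z], summing over the state reached. *)
Lemma realization_path_word s z w (t : int) :
  mu [set o | [/\ S t o = s,
    window (fun i => (X i o, S i o)) t (size z) = z
    & window (fun i => X i o) (t + (size z)%:Z) (size w) = w]] =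
  (init s * path_prob s z * future_prob (last s (unzip2 z)) w)%:E.
Proof.
elim: w z => [|x w IHw] z.
  rewrite future_prob_nil mulr1; case: XS => _ _ /(_ t s z) <-.
  by congr (mu _); apply/seteqP; split=> o /= => [[]|[]].
have mA : measurable [set o | [/\ S t o = s,
    window (fun i => (X i o, S i o)) t (size z) = z
    & window (fun i => X i o) (t + (size z)%:Z) (size (x :: w)) = x :: w]].
  rewrite (_ : mkset _ = [set o | S t o = s] `&`
    [set o | window (fun i => (X i o, S i o)) t (size z) = z] `&`
    [set o | window (fun i => X i o) (t + (size z)%:Z) (size (x :: w)) = x :: w]).
    do 2?[apply: measurableI]; rewrite //.
    by apply: (@measurable_window _ _ _ X) => i y _.
  by apply/seteqP; split=> o /= [] => [? ? ?|[]].
rewrite (measure_partition mu (S := S (t + (size z).+1%:Z))) //.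
rewrite future_prob_cons mulr_sumr -sumEFin; apply: eq_bigr => r _.
have := IHw (rcons z (x, r)).
rewrite path_prob_rcons /unzip2 map_rcons last_rcons !mulrA => <-.
congr (mu _); apply/seteqP; split=> o /=; rewrite size_rcons
  (window_rcons (fun i => (X i o, S i o)))
  (window_cons (fun i => X i o) (t + (size z)%:Z)).
  move=> [[-> -> [Xx]]]; have -> : t + (size z)%:Z + 1 = t + (size z).+1%:Z by lia.
  by rewrite -Xx => -> <-; split=> //; do 2!f_equal; congr X; lia.
move=> [-> /rcons_inj[-> Xx Ss]].
have -> : t + (size z)%:Z + 1 = t + (size z).+1%:Z by lia.
by rewrite Xx => ->.
Qed.

Lemma realization_word w (t : int) :
  mu [set o | window (fun i => X i o) t (size w) = w] = (word_prob G w)%:E.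
Proof.
rewrite (measure_partition mu (S := S t)) //; last first.
  by apply: (@measurable_window _ _ _ X) => i y _.
rewrite word_probE -sumEFin; apply: eq_bigr => s _.
have := realization_path_word s [::] w t; rewrite /= mulr1 => <-.
by congr (mu _); apply/seteqP; split=> o /=; rewrite addr0;
  [case=> -> ->|case=> -> _ ->].
Qed.

End Realization.

Lemma generates_word (P : process R) (t : int) w : generates G P ->
  P [set om : bisequence | window om t (size w) = w] = (word_prob G w)%:E.
Proof.
move=> [d [T [mu [X [S [XS PE]]]]]].
rewrite PE; first exact: realization_word XS w t.
exact: measurable_window_event.
Qed.

Lemma word_lawE (P : process R) w : generates G P ->
  word_law P w = word_prob G w.
Proof. by move=> GP; rewrite /word_law (generates_word 0 w GP). Qed.

Section EpsMachine.
Hypothesis epsG : eps_machine G.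

Lemma edge_prob_ge0 s x t : 0 <= edge_prob s x t.
Proof.
have [[_ /(_ s)[e0 _]] _ _ _ _] := epsG.
by rewrite /edge_prob; case: ifP.
Qed.

Lemma sum_edge_prob s x : \sum_t edge_prob s x t = emit s x.
Proof.
have [[_ /(_ s)[/(_ x) e0 _]] /(_ s x) stepE _ _ _] := epsG.
rewrite /edge_prob; case: (step s x) stepE => [t _|/esym e_le].
  rewrite (bigD1 t) //= eqxx big1 ?addr0 // => r /negbTE.
  by rewrite (inj_eq Some_inj) eq_sym => ->.
rewrite big1 //.
by apply/eqP; rewrite eq_le e0 leNgt e_le.
Qed.

Lemma future_prob1 s x : future_prob s [:: x] = emit s x.
Proof.
rewrite future_prob_cons -sum_edge_prob; apply: eq_bigr => r _.
by rewrite future_prob_nil mulr1.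
Qed.

Lemma future_prob_ge0 s w : 0 <= future_prob s w.
Proof.
elim: w s => [|x w IHw] s; first by rewrite future_prob_nil.
rewrite future_prob_cons; apply: sumr_ge0 => r _.
by rewrite mulr_ge0 ?edge_prob_ge0.
Qed.

Lemma word_prob_ge0 w : 0 <= word_prob G w.
Proof.
have [_ _ _ _ [[i0 _ _] _]] := epsG.
by rewrite word_probE sumr_ge0 // => s _; rewrite mulr_ge0 ?future_prob_ge0.
Qed.

Lemma word_prob_nil : word_prob G [::] = 1.
Proof.
have [_ _ _ _ [[_ i1 _] _]] := epsG.
by rewrite word_probE -i1; apply: eq_bigr => s _; rewrite future_prob_nil mulr1.
Qed.

Lemma word_prob_rcons w :
  word_prob G w = word_prob G (rcons w false) + word_prob G (rcons w true).
Proof.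
have [[_ emitP] _ _ _ _] := epsG.
rewrite -!cats1 !word_prob_cat -big_split; apply: eq_bigr => r _ /=.
have [_ e1] := emitP r.
by rewrite !future_prob1 -mulrDr addrC -[_ + _](big_bool _ (emit r)) e1 mulr1.
Qed.

(** This is where stationarity of [init] enters: summing over an additional first letter moves the
    initial law one step forward. *)
Lemma word_prob_cons w :
  word_prob G w = word_prob G (false :: w) + word_prob G (true :: w).
Proof.
have [_ _ _ _ [[_ _ istat] _]] := epsG.
rewrite !word_probE -big_split /=.
under [RHS]eq_bigr do rewrite !future_prob_cons -mulrDr -big_split mulr_sumr /=.
rewrite exchange_big; apply: eq_bigr => r _; rewrite -istat mulr_suml.
by apply: eq_bigr => s _; rewrite big_bool /=; ring.
Qed.

End EpsMachine.

(** Splitting according to the state reached between the two words factors the matrix through the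
    state space. *)
Lemma word_prob_rank (I J : nat) (f : 'I_I -> seq bool) (g : 'I_J -> seq bool) :
  (\rank (\matrix_(i < I, j < J) word_prob G (f i ++ g j)) <= #|state G|)%N.
Proof.
rewrite (_ : \matrix_(i, j) _ =
  (\matrix_(i < I, k < #|state G|) joint_prob (f i) (enum_val k)) *m
  (\matrix_(k < #|state G|, j < J) future_prob (enum_val k) (g j))).
  exact: mulmx_max_rank.
apply/matrixP => i j; rewrite !mxE word_prob_cat big_enum_val.
by apply: eq_bigr => k _; rewrite !mxE.
Qed.

End Presentations.

(** Successors are matched only on admissible pairs; on the others the emission is zero in both
    machines, and so are the edge probabilities. *)
Lemma isomorphic_word_prob (R : realType) (G G' : presentation R) w :
  eps_machine G -> isomorphic G G' -> word_prob G w = word_prob G' w.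
Proof.
case=> -[card_gt0 emitP] stepE _ _ _ [f [[g fK gK] fi fe fs]].
have fut v s : future_prob (f s) v = future_prob s v.
  elim: v s => [|x v IHv] s; first by rewrite !future_prob_nil.
  rewrite !future_prob_cons (reindex f) /=; last by exists g => ? _.
  apply: eq_bigr => r _; rewrite IHv /edge_prob fe; congr (_ * _).
  have [e0|] := boolP (0 < emit s x).
    by rewrite fs //; case: (step s x) => //= t; rewrite !(inj_eq Some_inj) (can_eq fK).
  rewrite -leNgt => e0; have -> : emit s x = 0.
    by apply/eqP; rewrite eq_le e0; have [-> _] := emitP s.
  by rewrite !if_same.
rewrite !word_probE [RHS](reindex f) /=; last by exists g => ? _.
by apply: eq_bigr => s _; rewrite fi fut.
Qed.

(** * Context machines with uniform stationary vector *)

Lemma ereal_inf_size (R : realType) (T : Type) (f : T -> nat) (A : set T) x0 :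
  A x0 -> (forall x, A x -> (f x0 <= f x)%N) ->
  ereal_inf [set ((f x)%:R : R)%:E | x in A] = ((f x0)%:R)%:E.
Proof.
move=> Ax0 lef; apply/le_anti/andP; split.
  by apply: ereal_inf_lbound; exists x0.
by apply: le_ereal_inf_tmp => _ [x Ax <-]; rewrite lee_fin ler_nat lef.
Qed.

Lemma bigmaxe_const (R : realType) (I : finType) (Q : pred I) (F : I -> \bar R) c i0 :
  Q i0 -> (0 <= c)%E -> (forall i, Q i -> F i = c) ->
  \big[maxe/0%E]_(i | Q i) F i = c.
Proof.
move=> Qi0 c0 Fc; apply/le_anti/andP; split.
  by apply: bigmax_le => // i Qi; rewrite Fc.
by rewrite -(Fc i0 Qi0); apply: le_bigmax_cond.
Qed.

(** The strict maximum principle for a two-point average, from which a stationary vector will be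
    shown constant. *)
Lemma convex_extreme (R : realType) (a b m x y : R) :
  0 < x -> 0 < y -> x + y = 1 -> a <= m -> b <= m -> m = a * x + b * y ->
  a = m /\ b = m.
Proof.
move=> x0 y0 xy am bm mE.
have /eqP : (m - a) * x + (m - b) * y = m * (x + y) - (a * x + b * y) by ring.
have a0 : 0 <= (m - a) * x by apply: mulr_ge0; [rewrite subr_ge0|exact: ltW].
have b0 : 0 <= (m - b) * y by apply: mulr_ge0; [rewrite subr_ge0|exact: ltW].
rewrite xy mulr1 -mE subrr paddr_eq0 // !mulf_eq0.
rewrite !(gt_eqF x0, gt_eqF y0) !orbF !subr_eq0.
by move=> /andP[/eqP <- /eqP <-].
Qed.

Section BalancedContextMachine.
Variables (R : realType) (n : nat) (p : n.+1.-tuple bool -> R).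
Local Notation context := (n.+1.-tuple bool).
Implicit Types (s t u r : context) (x b : bool) (w v : seq bool).

(** [u] and [flip u] have the same successor under each letter, since an update forgets the first
    letter. *)
Definition flip u : context := [tuple of ~~ thead u :: behead u].

Definition uniform u : R := (2 ^+ n.+1)^-1.

Hypothesis p01 : forall u, 0 < p u < 1.
(* The condition on p under which the uniform vector is stationary. *)
Hypothesis p_flip : forall u, p (flip u) = 1 - p u.
Hypothesis p_inj : injective p.

Let M : presentation R := context_presentation p uniform.

Let e u x : R := if x then p u else 1 - p u.
Let next u x : context := [tuple of behead (rcons u x)].
(** [belast b t] is [b] followed by [t] without its last letter: the two values of [b] give the two
    predecessors of [t]. *)
Let prev b t : context := [tuple of belast b t].
Let c : R := (2 ^+ n.+1)^-1.

Let c_gt0 : 0 < c. Proof. by rewrite invr_gt0 exprn_gt0. Qed.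

Let e_gt0 u x : 0 < e u x.
Proof. by have := p01 u; rewrite /e; case: x; lra. Qed.

Lemma flip_neq u : flip u != u.
Proof.
apply/eqP => /(congr1 val); case/tupleP: u => b u; rewrite /= theadE /=.
by case; case: b.
Qed.

Let e_flip u x : e (flip u) x = 1 - e u x.
Proof. by rewrite /e p_flip; case: x; lra. Qed.

Let flip_prev b t : flip (prev b t) = prev (~~ b) t.
Proof.
by apply: val_inj; case/tupleP: t => y t; rewrite /flip /= /thead (tnth_nth false).
Qed.

Let lastt t := last false t.

Let next_prev b t : next (prev b t) (lastt t) = t.
Proof.
apply: val_inj; case/tupleP: t => y t; rewrite /= /lastt /=.
by rewrite -lastI.
Qed.

Let prev_next u x : prev (thead u) (next u x) = u.
Proof.
apply: val_inj; case/tupleP: u => y u; rewrite /= theadE /=.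
by rewrite belast_rcons.
Qed.

Let last_next u x : lastt (next u x) = x.
Proof. by case/tupleP: u => y u; rewrite /lastt /= last_rcons. Qed.

Let edgeE u x t : edge_prob (u : state M) x t = e u x * (next u x == t)%:R.
Proof.
rewrite /edge_prob /= (inj_eq Some_inj) -/(next u x) /e.
by case: (next u x == t); rewrite ?mulr1 ?mulr0.
Qed.

(** Every edge into [t] carries the last letter of [t] and leaves one of its two predecessors. *)
Let sum_next (F : context -> R) x t :
  \sum_r F r * (next r x == t)%:R =
  (x == lastt t)%:R * (F (prev false t) + F (prev true t)).
Proof.
have [->|xt] := eqVneq x (lastt t); last first.
  rewrite mul0r big1 // => r _; have [rt|] := eqVneq; last by rewrite mulr0.
  by move: xt; rewrite -rt last_next eqxx.
rewrite mul1r (bigD1 (prev false t)) //= next_prev eqxx mulr1.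
have neq : prev true t != prev false t.
  by rewrite -[true]/(~~ false) -flip_prev flip_neq.
rewrite (bigD1 (prev true t)) //= next_prev eqxx mulr1 big1 ?addr0 // => r.
case/andP=> r0 r1; have [rt|] := eqVneq; last by rewrite mulr0.
move: r0 r1; rewrite -(prev_next r (lastt t)) rt.
by case: (thead r); rewrite eqxx.
Qed.

(** The balance identity: each state receives total mass one from its predecessors, so the one-step
    matrix is doubly stochastic. *)
Let e_prev t x : e (prev false t) x + e (prev true t) x = 1.
Proof. by rewrite -[true]/(~~ false) -flip_prev e_flip; lra. Qed.

(** The letters read form the end of the current state. Each further letter pushes out one letter of
    the initial context, and summing over the latter keeps the weight [c] by [e_prev]. *)
Lemma joint_prob_short w t : (size w <= n.+1)%N ->
  joint_prob w (t : state M) = c * (w == drop (n.+1 - size w) t)%:R.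
Proof.
elim/last_ind: w t => [|w x IHw] t.
  by rewrite joint_prob_nil drop_oversize ?size_tuple // eqxx mulr1.
rewrite size_rcons => lewn; rewrite joint_prob_rcons.
transitivity (\sum_(r : context) (c * (w == drop (n.+1 - size w) r)%:R * e r x) *
    (next r x == t)%:R).
  by apply: eq_bigr => r _; rewrite edgeE IHw ?(ltnW lewn) // !mulrA.
rewrite sum_next.
(* As [size w < n.+1], at least the first letter is dropped, so the condition cannot tell the two
   predecessors apart. *)
have dropE b : drop (n.+1 - size w) (prev b t) = drop (n.+1 - size w) (prev true t).
  by rewrite subSn //; case/tupleP: t => y t.
rewrite (dropE false) -mulrDr e_prev mulr1 mulrCA -natrM; congr (c * _%:R).
have -> : drop (n.+1 - (size w).+1) t =
    rcons (drop (n.+1 - size w) (prev true t)) (lastt t).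
  rewrite -drop_rcons ?size_tuple ?leq_subr //.
  have -> : rcons (prev true t) (lastt t) = true :: t.
    by case/tupleP: (t) => y t'; rewrite /lastt /= -lastI.
  by rewrite subSS subSn.
rewrite eqseq_rcons mulnC mulnb //.
Qed.

Let sum_flow (F : context -> R) t :
  \sum_(s : state M) F s * (\sum_x edge_prob s x t) =
  F (prev false t) * e (prev false t) (lastt t) +
  F (prev true t) * e (prev true t) (lastt t).
Proof.
transitivity (\sum_x \sum_(r : context) (F r * e r x) * (next r x == t)%:R).
  rewrite exchange_big; apply: eq_bigr => r _; rewrite mulr_sumr.
  by apply: eq_bigr => x _; rewrite edgeE mulrA.
under eq_bigr do rewrite sum_next.
rewrite (bigD1 (lastt t)) //= eqxx mul1r big1 ?addr0 // => x /negbTE ->.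
by rewrite mul0r.
Qed.

Let stationary_uniform : stationary_vector (uniform : state M -> R).
Proof.
split=> [s||t]; first exact: ltW.
  by rewrite sumr_const card_tuple card_bool -[LHS]mulr_natl natrX mulfV //
    gt_eqF // exprn_gt0.
by rewrite sum_flow -mulrDr e_prev mulr1.
Qed.

Let edge_next u x : edge (u : state M) (next u x).
Proof. by apply/existsP; exists x; rewrite /= eqxx andbT; exact: e_gt0. Qed.

Lemma foldl_next u w : foldl next u w = drop (size w) (u ++ w) :> seq bool.
Proof.
elim/last_ind: w => [|w x IHw]; first by rewrite cats0 drop0.
rewrite foldl_rcons /= IHw -drop1 -drop_rcons; last by rewrite size_cat leq_addl.
by rewrite drop_drop rcons_cat size_rcons.
Qed.

Let foldl_next_id u t : foldl next u t = t.
Proof.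
by apply: val_inj; rewrite /= foldl_next size_tuple drop_size_cat ?size_tuple.
Qed.

(** Reading the word [t] leads from any state to the state [t]. *)
Let connect_context u t : connect (@edge R M) u t.
Proof.
rewrite -(foldl_next_id u t); move: (val t) => w; elim: w u => [|x w IHw] u /=.
  exact: connect0.
exact: connect_trans (connect1 (edge_next u x)) (IHw _).
Qed.

Let stationary_unique (rho : state M -> R) :
  stationary_vector rho -> rho = uniform.
Proof.
move=> [rho0 rho1 rhoT].
(* A maximal value of rho at t is taken at both predecessors of t too. *)
have rho_prev t : rho t = rho (prev false t) * e (prev false t) (lastt t) +
    rho (prev true t) * e (prev true t) (lastt t).
  by rewrite -[LHS]rhoT sum_flow.
have [t0 _ max0] :=
  @arg_maxP _ _ _ (prev true [tuple of nseq n.+1 true]) xpredT rho isT.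
have back s t : edge (s : state M) t -> rho t = rho t0 -> rho s = rho t0.
  move=> /existsP[x /andP[_ /eqP[st]]] rt.
  have -> : s = prev (thead s) t by rewrite -st prev_next.
  have := rho_prev t; rewrite rt => h.
  have m1 := max0 (prev false t) isT; have m2 := max0 (prev true t) isT.
  have e1 := e_gt0 (prev false t) (lastt t).
  have e2 := e_gt0 (prev true t) (lastt t).
  have e12 := e_prev t (lastt t).
  have [h1 h2] := convex_extreme e1 e2 e12 m1 m2 h.
  by case: (thead s).
(* Strong connectivity carries the maximal value backwards from [t0] to every state. *)
have const s : rho s = rho t0.
  have /connectP[q sq tq] := connect_context s t0.
  elim: q s sq tq => [|r q IHq] s /=; first by move=> _ ->.
  by move=> /andP[sr rq] tq; apply: back sr _; exact: IHq.
apply/funext => s; rewrite const; move: rho1.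
rewrite (eq_bigr _ (fun s _ => const s)) sumr_const card_tuple card_bool => h.
apply: (mulIf (x := (2 ^ n.+1)%:R)); first by rewrite pnatr_eq0 expn_eq0.
by rewrite mulr_natr h natrX mulVf // gt_eqF // exprn_gt0.
Qed.

Let sum_emit s : \sum_x e s x = 1.
Proof. by rewrite big_bool /= /e; lra. Qed.

Let future_next s x w :
  future_prob (s : state M) (x :: w) = e s x * future_prob (next s x : state M) w.
Proof.
rewrite future_prob_cons (bigD1 (next s x)) //= edgeE eqxx mulr1.
rewrite big1 ?addr0 // => r /negbTE rs.
by rewrite edgeE eq_sym rs mulr0 mul0r.
Qed.

Let future1 s x : future_prob (s : state M) [:: x] = e s x.
Proof. by rewrite future_next future_prob_nil mulr1. Qed.

Let separated s t : s != t ->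
  future_prob (s : state M) [:: true] != future_prob (t : state M) [:: true].
Proof. by rewrite !future1 /e (inj_eq p_inj). Qed.

Lemma context_eps_machine : eps_machine M.
Proof.
split; last by split; [exact: stationary_uniform|exact: stationary_unique].
- split; first by rewrite card_tuple card_bool expn_gt0.
  by move=> s; split=> [x|]; [exact/ltW/e_gt0|exact: sum_emit].
- by move=> s x; apply/esym; exact: e_gt0.
- exact: connect_context.
- by move=> s t /eqP st; exists [:: true]; apply/eqP; exact: separated.
Qed.

Let trans_foldl u w t : trans_prob (u : state M) w t =
  (foldl next u w == t)%:R * future_prob (u : state M) w.
Proof.
elim: w u => [|x w IHw] u; first by rewrite future_prob_nil mulr1.
rewrite future_next /= (bigD1 (next u x)) //= edgeE eqxx mulr1 big1 ?addr0.
  by rewrite IHw mulrCA.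
by move=> r /negbTE ru; rewrite edgeE eq_sym ru mulr0 mul0r.
Qed.

Let joint_context t s : joint_prob t (s : state M) = c * (t == s)%:R.
Proof. by rewrite joint_prob_short ?size_tuple // subnn drop0 -val_eqE. Qed.

Lemma word_prob_context_cat (t : context) w :
  word_prob M (t ++ w) = c * future_prob (t : state M) w.
Proof.
rewrite word_prob_cat (bigD1 t) //= joint_context eqxx mulr1 big1 ?addr0 //.
by move=> s /negbTE st; rewrite joint_context eq_sym st mulr0 mul0r.
Qed.

Lemma word_prob_context (t : context) : word_prob M t = c.
Proof. by rewrite -[val t]cats0 word_prob_context_cat future_prob_nil mulr1. Qed.

Lemma word_prob_context_rcons (t : context) x :
  word_prob M (rcons t x) = c * e t x.
Proof. by rewrite -cats1 word_prob_context_cat future1. Qed.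

Lemma context_synchronizes (t : context) : synchronizes_to t (t : state M).
Proof.
rewrite /synchronizes_to word_prob_context joint_context eqxx mulr1.
by rewrite divff ?gt_eqF.
Qed.

(** After a word shorter than the context, [t] and [flip t] are equally likely, so neither can carry
    all the mass. *)
Lemma synchronizes_size w t : synchronizes_to w (t : state M) -> (n.+1 <= size w)%N.
Proof.
move=> [w0 wt]; rewrite leqNgt; apply/negP => ltwn.
have jw : joint_prob w (t : state M) = word_prob M w.
  by rewrite -[LHS](divfK (lt0r_neq0 w0)) wt mul1r.
have jt s : joint_prob w (s : state M) = c * (w == drop (n.+1 - size w) s)%:R.
  by rewrite joint_prob_short // ltnW.
have jflip : joint_prob w (flip t : state M) = joint_prob w (t : state M).
  rewrite !jt; congr (c * (_ == _)%:R); rewrite subSn //.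
  by case/tupleP: (t) => y t'.
move: (jw); rewrite {1}/word_prob (bigD1 t) //= (bigD1 (flip t)) ?flip_neq //= jflip.
have : 0 <= \sum_(i | (i != t) && (i != flip t)) joint_prob w (i : state M).
  by apply: sumr_ge0 => i _; rewrite jt mulr_ge0 // ltW.
move: w0; rewrite -jw; lra.
Qed.

Lemma context_exact : exact M.
Proof. by exists [tuple of nseq n.+1 true]; eexists; exact: context_synchronizes. Qed.

Lemma context_L_tar : L_tar M = (n.+1%:R)%:E.
Proof.
apply: (bigmaxe_const (i0 := [tuple of nseq n.+1 true])) => // s _.
rewrite (ereal_inf_size _ (x0 := s : seq bool)); last 2 first.
- exact: context_synchronizes.
- by move=> w /synchronizes_size; rewrite size_tuple.
by rewrite size_tuple.
Qed.

Lemma context_L_syn : L_syn M = (n.+1%:R)%:E.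
Proof.
apply: (@ereal_inf_size R nat id _ n.+1) => [w /eqP sw _|k kS].
  by exists (Tuple sw); exact: (context_synchronizes (Tuple sw)).
rewrite leqNgt; apply/negP => ltkn.
(* For k < n + 1 the word of [k] ones has positive probability, being a suffix of [s0], but is too
   short to synchronize. *)
pose s0 : context := nseq_tuple n.+1 true.
have s0E : s0 = nseq n.+1 true :> seq bool by [].
pose w := nseq k true.
have sw : size w = k by rewrite size_nseq.
have w0 : 0 < word_prob M w.
  apply: lt_le_trans c_gt0 _; rewrite /word_prob (bigD1 s0) //=.
  rewrite joint_prob_short sw 1?ltnW // s0E drop_nseq subKn 1?ltnW // eqxx mulr1 lerDl.
  by apply: sumr_ge0 => i _; rewrite joint_prob_short sw 1?ltnW // mulr_ge0 // ltW.
have [s /synchronizes_size] := kS w sw w0.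
by rewrite sw leqNgt ltkn.
Qed.

Lemma context_L_sep : L_sep M = 1%:E.
Proof.
pose s0 : context := [tuple of nseq n.+1 true].
apply: (bigmaxe_const (i0 := (s0, flip s0))) => [|//|[s t] /= st].
  by rewrite eq_sym flip_neq.
rewrite (ereal_inf_size _ (x0 := [:: true])) //; first exact: separated.
by move=> [|x w] //=; rewrite !future_prob_nil eqxx.
Qed.

(** A vector killed by all words of length k + 1 has one-step images killed by all words of length
    k, and these vanish by induction. What remains is one 2 x 2 system for each pair [u], [flip u],
    with determinant 1 - 2 [p u]; this is nonzero because [p u] differs from [p (flip u)]. *)
Let trans_prob_injective k (b : context -> R) :
  (forall v t, size v = k -> \sum_u b u * trans_prob (u : state M) v t = 0) ->
  forall u, b u = 0.
Proof.
elim: k b => [|k IHk] b bv u.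
  have := bv [::] u erefl; rewrite (bigD1 u) //= eqxx mulr1 big1 ?addr0 //.
  by move=> t /negbTE ->; rewrite mulr0.
have flow x r : \sum_s b s * edge_prob (s : state M) x r = 0.
  move: r; apply: (IHk (fun r => \sum_s b s * edge_prob (s : state M) x r)).
  move=> v t sv; rewrite -[RHS](bv (x :: v) t) /= ?sv //.
  under eq_bigr do rewrite mulr_suml.
  rewrite exchange_big; apply: eq_bigr => s _; rewrite mulr_sumr.
  by apply: eq_bigr => r _; rewrite mulrA.
have pair x : b u * e u x + b (flip u) * e (flip u) x = 0.
  have := flow x (next u x); under eq_bigr do rewrite edgeE mulrA.
  rewrite (sum_next (fun s => b s * e s x)) last_next eqxx mul1r.
  move: (next u x) (prev_next u x) => r rE.
  have -> : flip u = prev (~~ thead u) r by rewrite -flip_prev rE.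
  by rewrite -{1 2}rE; case: (thead u) => //=; rewrite addrC.
have := pair true; have := pair false; rewrite /e p_flip => h0 h1.
have pu : p u - (1 - p u) != 0.
  by rewrite subr_eq0 -p_flip (inj_eq p_inj) eq_sym flip_neq.
apply: (mulIf pu); rewrite mul0r.
have bf : b (flip u) = - b u by lra.
by rewrite bf in h1; lra.
Qed.

(** The entry at contexts s, t is [c] times the probability of reading [t] from [s]. As reading [t]
    always ends in [t], this is a transition probability, and [trans_prob_injective] makes the left
    kernel trivial. *)
Lemma word_prob_context_rank :
  \rank (\matrix_(i < #|{: context}|, j < #|{: context}|)
           word_prob M (enum_val i ++ enum_val j)) = (2 ^ n.+1)%N.
Proof.
set H := \matrix_(i, j) _.
suff : row_free H by move=> /eqP ->; rewrite card_tuple card_bool.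
apply: inj_row_free => a aH.
suff a0 u : a 0 (enum_rank u) = 0.
  by apply/rowP => i; rewrite mxE -[i]enum_valK a0.
apply: (@trans_prob_injective n.+1 (fun u => a 0 (enum_rank u))) => v t sv.
have vt : v = Tuple (introT eqP sv) by [].
have [vE|vE] := eqVneq (Tuple (introT eqP sv)) t; last first.
  rewrite big1 // => s _; rewrite trans_foldl vt foldl_next_id (negbTE vE).
  by rewrite mul0r mulr0.
rewrite vt vE; have /rowP/(_ (enum_rank t)) := aH; rewrite !mxE => at0.
apply: (mulIf (lt0r_neq0 c_gt0)); rewrite mul0r -[RHS]at0 mulr_suml.
rewrite [RHS](reindex enum_rank) /=; last first.
  by exists enum_val => i _; rewrite ?enum_valK ?enum_rankK.
apply: eq_bigr => s _; rewrite mxE !enum_rankK word_prob_context_cat.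
by rewrite trans_foldl foldl_next_id eqxx mul1r -mulrA [_ * c]mulrC.
Qed.

(** * The process generated by a balanced context machine *)

Section ContextProcess.
Variable P : process R.
Hypothesis PM : forall (t : int) (w : seq bool),
  P [set om : bisequence | window om t (size w) = w] = (word_prob M w)%:E.

(** The hidden state at time [t] is read off the observed symbols at t - n, ..., t, so the space of
    bisequences already carries the joint process. *)
Let memory (t : int) (om : bisequence) : context :=
  Tuple (introT eqP (size_window om (t - n.+1%:Z) n.+1)).

Let memoryD1 (t : int) om : memory (t + 1) om = next (memory t om) (om (t + 1)).
Proof.
apply: val_inj.
rewrite -[RHS]/(behead (rcons (window om (t - n.+1%:Z) n.+1) (om (t + 1)))).
have := window_rcons om (t - n.+1%:Z) n.+1.
have -> : t - n.+1%:Z + n.+2%:Z = t + 1 by lia.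
by rewrite window_cons => <- /=; congr window; lia.
Qed.

Let window_memory om (t : int) k :
  window (fun i => (om i, memory i om)) t k =
  zip (window om t k) (scanl next (memory t om) (window om t k)).
Proof. by elim: k t => [|k IHk] t //; rewrite !window_cons /= IHk memoryD1. Qed.

Let path_prob_scan s (z : seq (bool * state M)) : path_prob (s : state M) z =
  (unzip2 z == scanl next s (unzip1 z))%:R *
  future_prob (s : state M) (unzip1 z).
Proof.
elim: z s => [|[x r] z IHz] s /=; first by rewrite future_prob_nil mulr1.
rewrite IHz edgeE future_next eqseq_cons [r == _]eq_sym.
have [->|_] := eqVneq; last by rewrite mulr0 !mul0r.
by rewrite mulr1 mulrCA.
Qed.

(** A labeled path incompatible with the updates has probability zero on both sides. For a
    compatible one, the event only prescribes the context [s] followed by the symbols of the path,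
    which is a window event. *)
Lemma context_generates : generates M P.
Proof.
exists _, bisequence, P, (fun (i : int) om => om i), memory; split=> //; split.
- by move=> t x; exact: measurable_coordinate.
- move=> t s; rewrite (_ : mkset _ =
    [set om : bisequence | window om (t - n.+1%:Z) n.+1 = s]).
    exact: measurable_window_event.
  by apply/seteqP; split=> om /= => [<-|h] //; exact: val_inj.
- move=> t s z; rewrite path_prob_scan.
  have [zE|zN] := eqVneq; last first.
    rewrite mul0r mulr0 (_ : mkset _ = set0) ?measure0 //.
    apply/seteqP; split=> om //= [ms]; rewrite window_memory ms => wz; move: zN.
    have -> : unzip1 z = window om t (size z).
      by rewrite -{1}wz unzip1_zip ?size_scanl.
    by rewrite -{1}wz unzip2_zip ?size_scanl ?eqxx.
  rewrite mul1r -[init _]/c -word_prob_context_cat -(PM (t - n.+1%:Z)).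
  congr (P _); apply/seteqP; split=> om /=;
    rewrite size_cat size_tuple size_map window_cat subrK.
    move=> [ms wz]; rewrite -{1}ms; congr (_ ++ _).
    by rewrite -{2}wz window_memory unzip1_zip ?size_scanl.
  move/eqP; rewrite eqseq_cat ?size_window ?size_tuple //.
  move=> /andP[/eqP ws /eqP wz].
  have ms : memory t om = s by exact: val_inj.
  by split=> //; rewrite window_memory ms wz -zE zip_unzip.
Qed.

Let PM_law w : word_law P w = word_prob M w.
Proof. exact: word_lawE context_generates. Qed.

Lemma context_hankel_rank : has_rank (hankel P) (2 ^ n.+1).
Proof.
split.
  exists #|{: context}|, #|{: context}|, (fun i => val (enum_val i)),
    (fun i => val (enum_val i)).
  rewrite -[RHS]word_prob_context_rank; congr (\rank _).
  by apply/matrixP => i j; rewrite !mxE /hankel PM_law.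
move=> k l f g; rewrite (_ : \matrix_(i, j) _ =
  \matrix_(i, j) word_prob M (f i ++ g j)).
  by have := word_prob_rank M f g; rewrite card_tuple card_bool.
by apply/matrixP => i j; rewrite !mxE /hankel PM_law.
Qed.

(** The default value in [insubd] concerns only words that are not of length n + 1. *)
Let word_prob_next (u v : seq bool) x : size v = n.+1 ->
  word_prob M (u ++ rcons v x) =
  e (insubd [tuple of nseq n.+1 true] v) x * word_prob M (u ++ v).
Proof.
move=> sv; have -> : v = Tuple (introT eqP sv) by [].
set t := Tuple _; rewrite valKd -cats1 catA word_prob_cat /word_prob mulr_sumr.
apply: eq_bigr => r _; rewrite future1 mulrC.
have [->//|tr] := eqVneq r t.
rewrite joint_prob_cat big1 ?mulr0 // => s _.
by rewrite trans_foldl foldl_next_id eq_sym (negbTE tr) mul0r mulr0.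
Qed.

Lemma context_markov_order : markov_order P n.+1.
Proof.
split.
  apply: (window_law_depends PM (g := fun v x =>
    e (insubd [tuple of nseq n.+1 true] v) x)) => [v x|u v x].
    exact/ltW.
  exact: word_prob_next.
(* A shorter memory would make [p u] independent of the first letter of [u], against injectivity of
   [p]. *)
move=> j Pj; rewrite leqNgt; apply/negP => ltjn.
have [g gE] := depends_on_last_next PM (ltnW ltjn) Pj.
pose s : context := nseq_tuple n.+1 true.
have ps u : p u = g (drop (n.+1 - j) u) true.
  have := gE u true (size_tuple u).
  rewrite word_prob_context_rcons word_prob_context mulrC.
  by move/(mulIf (lt0r_neq0 c_gt0)).
have : p (flip s) = p s by rewrite !ps subSn.
by move/p_inj/eqP; rewrite (negbTE (flip_neq s)).
Qed.

Lemma context_Theta_ex : Theta_ex n.+1 1 P.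
Proof.
split; first exact: window_law_stationary PM.
exists M; split.
- by split; [exact: context_eps_machine|exact: context_exact|exact: context_generates].
- by rewrite context_L_tar.
- by rewrite context_L_sep.
Qed.

End ContextProcess.

Lemma context_process_exists : exists P : process R, forall (t : int) (w : seq bool),
  P [set om : bisequence | window om t (size w) = w] = (word_prob M w)%:E.
Proof.
have epsM := context_eps_machine.
apply: stationary_binary_process.
- exact: word_prob_ge0.
- exact: word_prob_nil.
- exact: word_prob_rcons.
- exact: word_prob_cons.
Qed.

End BalancedContextMachine.

(** * Two machines with the same block law *)

Section BiasedParameters.
Variables (R : realType) (n : nat).
Implicit Types (a : R) (u v : n.+1.-tuple bool).

(** The tails of length [n] are numbered and spread over ]0, 1[, so that distinct tails get distinct
    positive amplitudes. *)
Definition amplitude u : R :=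
  (enum_rank (behead_tuple u)).+1%:R / (#|{: n.-tuple bool}|.+1)%:R.

(** The first letter chooses the side of 1/2, which yields the balance condition; the scale [a] is
    the freedom that words of length n + 1 do not detect. *)
Definition bias a u : R :=
  (1 + a * (if thead u then amplitude u else - amplitude u)) / 2.

Lemma amplitude_bounds u : 0 < amplitude u < 1.
Proof.
by rewrite divr_gt0 ?ltr0n //= ltr_pdivrMr ?ltr0n // mul1r ltr_nat ltnS ltn_ord.
Qed.

Lemma amplitude_flip u : amplitude (flip u) = amplitude u.
Proof.
rewrite /amplitude; congr ((enum_rank _).+1%:R / _).
by apply: val_inj; case/tupleP: u.
Qed.

Lemma bias01 a u : 0 < a <= 1 -> 0 < bias a u < 1.
Proof.
move=> a01; rewrite /bias; have := amplitude_bounds u.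
by case: (thead u) => amp; apply/andP; split; nra.
Qed.

Lemma bias_flip a u : bias a (flip u) = 1 - bias a u.
Proof.
rewrite /bias amplitude_flip; have -> : thead (flip u) = ~~ thead u by [].
by case: (thead u) => /=; lra.
Qed.

(** As amplitudes are positive, the sign of the deviation from 1/2 recovers the first letter and its
    size recovers the tail. *)
Lemma bias_inj a : 0 < a -> injective (bias a).
Proof.
move=> a0 u v uv.
have {uv} : (if thead u then amplitude u else - amplitude u) =
    (if thead v then amplitude v else - amplitude v).
  by apply: (mulfI (lt0r_neq0 a0)); move: uv; rewrite /bias; lra.
have := amplitude_bounds u; have := amplitude_bounds v.
have amp_inj : amplitude u = amplitude v -> thead u = thead v -> u = v.
  rewrite /amplitude => /(mulIf _) amp uv.
  apply: val_inj; rewrite (tuple_eta u) (tuple_eta v) /= uv; congr cons.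
  have {amp}/eqP : (enum_rank (behead_tuple u)).+1%:R =
      (enum_rank (behead_tuple v)).+1%:R :> R.
    by apply: amp; rewrite invr_neq0 // pnatr_eq0.
  by rewrite eqr_nat eqSS => /eqP/val_inj/enum_rank_inj/(congr1 val).
move: amp_inj; case: (thead u); case: (thead v) => amp_inj av au h.
- exact: amp_inj.
- by exfalso; lra.
- by exfalso; lra.
- by apply: amp_inj => //; lra.
Qed.

End BiasedParameters.

Theorem proposition6p2 (R : realType) (m : nat) (hm : (1 <= m)%N) :
  (exists (GP GQ : presentation R) (P Q : process R),
     [/\ full_support_context m GP /\ full_support_context m GQ,
         ~ isomorphic GP GQ,
         generates GP P /\ generates GQ Q,
         (eps_machine GP /\ exact GP) /\ (eps_machine GQ /\ exact GQ)
       & [/\ #|state GP| = (2 ^ m)%N /\ #|state GQ| = (2 ^ m)%N,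
             L_tar GP = m%:R%:E /\ L_tar GQ = m%:R%:E,
             L_sep GP = 1%:E /\ L_sep GQ = 1%:E,
             L_syn GP = m%:R%:E /\ L_syn GQ = m%:R%:E
           & [/\ markov_order P m /\ markov_order Q m,
                 has_rank (hankel P) (2 ^ m) /\ has_rank (hankel Q) (2 ^ m),
                 block_law P m = block_law Q m
               & block_law P m.+1 <> block_law Q m.+1]]])
  /\ ~ uniform_identifiability (Theta_ex m 1)
         (fun P : process R => block_law P m)
  /\ (exists P Q : process R,
        [/\ Theta_ex m 1 P, Theta_ex m 1 Q,
            block_law P m = block_law Q m
          & forall GP GQ : presentation R,
              exact_presentation GP P -> exact_presentation GQ Q ->
              ~ isomorphic GP GQ]).
Proof.
case: m hm => // n _.
have one01 : 0 < (1 : R) <= 1 by rewrite ltr01 lexx.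
have half01 : 0 < (2^-1 : R) <= 1 by lra.
(* Any two distinct scales in ]0, 1] would do. *)
pose p := @bias R n 1; pose q := @bias R n 2^-1.
have p01 u : 0 < p u < 1 by exact: bias01.
have q01 u : 0 < q u < 1 by exact: bias01.
have pF u : p (flip u) = 1 - p u by exact: bias_flip.
have qF u : q (flip u) = 1 - q u by exact: bias_flip.
have pI : injective p by apply: bias_inj; lra.
have qI : injective q by apply: bias_inj; lra.
have [P PM] := context_process_exists p01 pF pI.
have [Q QM] := context_process_exists q01 qF qI.
have genP := context_generates pF PM.
have genQ := context_generates qF QM.
have eqm : block_law P n.+1 = block_law Q n.+1.
  apply/funext => w; rewrite /block_law (word_lawE _ genP) (word_lawE _ genQ).
  by rewrite (word_prob_context pF) (word_prob_context qF).
have neqm : block_law P n.+2 <> block_law Q n.+2.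
  (* On the word [u] followed by a one, the laws differ because [amplitude u] is positive and the
     scales are distinct. *)
  pose u := nseq_tuple n.+1 true.
  move=> /(congr1 (fun f => f [tuple of rcons u true])).
  rewrite /block_law (word_lawE _ genP) (word_lawE _ genQ).
  rewrite (word_prob_context_rcons pF) (word_prob_context_rcons qF).
  have c0 : (2 ^+ n.+1)^-1 != 0 :> R by rewrite invr_neq0 // expf_neq0.
  move/(mulfI c0); rewrite /p /q /bias /=; have := amplitude_bounds R u; lra.
(* Isomorphic machines give equal word probabilities, so the block laws of length n + 2 exclude an
   isomorphism whichever machines present [P] and [Q]. *)
have niso GP GQ : exact_presentation GP P -> exact_presentation GQ Q ->
    ~ isomorphic GP GQ.
  move=> [epsP _ GPP] [_ _ GQQ] iso; apply: neqm; apply/funext => w.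
  rewrite /block_law (word_lawE _ GPP) (word_lawE _ GQQ).
  exact: isomorphic_word_prob.
have epsP := context_eps_machine p01 pF pI.
have epsQ := context_eps_machine q01 qF qI.
have exP := context_exact pF.
have exQ := context_exact qF.
have eP : exact_presentation (context_presentation p (@uniform R n)) P by [].
have eQ : exact_presentation (context_presentation q (@uniform R n)) Q by [].
have thP := context_Theta_ex p01 pF pI PM.
have thQ := context_Theta_ex q01 qF qI QM.
split; last split.
- exists (context_presentation p (@uniform R n)),
    (context_presentation q (@uniform R n)), P, Q.
  split=> //.
  + by split; [exists p, (@uniform R n)|exists q, (@uniform R n)].
  + exact: niso eP eQ.
  + split.
    * by rewrite card_tuple card_bool.
    * by rewrite (context_L_tar pF) (context_L_tar qF).
    * by rewrite (context_L_sep pI) (context_L_sep qI).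
    * by rewrite (context_L_syn pF) (context_L_syn qF).
    split=> //.
    * by split; [exact: (context_markov_order p01 pF pI PM)
                |exact: (context_markov_order q01 qF qI QM)].
    * by split; [exact: (context_hankel_rank pF pI PM)
                |exact: (context_hankel_rank qF qI QM)].
- by move=> ident; apply: (niso _ _ eP eQ); exact: (ident P Q).
- by exists P, Q.
Qed.
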